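(* Let $L$ be a consistent normal extension of $\mathbf{CL}$, let $\Gamma$ be a set of $\mathcal{L}(\Box,\rhd)$-formulas and let $\varphi$ be an $\mathcal{L}(\Box,\rhd)$-formula. If $\Gamma \models_L^T \varphi$, then $\Gamma_0 \models_L^T \varphi$ for some finite subset $\Gamma_0$ of $\Gamma$.
   Context: The language $\mathcal{L}(\Box,\rhd)$ has countably many propositional variables $p_0,p_1,\dots$, constants $\top,\bot$, connectives $\neg,\land,\lor,\to$, unary modal operators $\Box,\Diamond$ (with $\Diamond$ the dual of $\Box$) and a binary modal operator $\rhd$. $\mathbf{CL}$ is the smallest set of $\mathcal{L}(\Box,\rhd)$-formulas containing all propositional tautologies, $\Box(p\to q)\to(\Box p\to\Box q)$, $\Box(\Box p\to p)\to\Box p$, and the axioms J1: $\Box(p\to q)\to(p\rhd q)$; J2: $(p\rhd q)\land(q\rhd r)\to(p\rhd r)$; J3: $(p\rhd r)\land(q\rhd r)\to((p\lor q)\rhd r)$; J4: $(p\rhd q)\to(\Diamond p\to\Diamond q)$, and closed under modus ponens, necessitation ($\varphi/\Box\varphi$) and substitution. A normal extension of $\mathbf{CL}$ is a set $L\supseteq\mathbf{CL}$ of formulas closed under these three rules; it is consistent if $\bot\notin L$. For a topology $\tau$ on $X$ and $Y\subseteq X$, the derived set is $d_\tau(Y)=\{x\in X : \text{for every } U\in\tau \text{ with } x\in U \text{ there is } y\neq x \text{ with } y\in U\cap Y\}$, and $cd_\tau(Y)=X\setminus d_\tau(X\setminus Y)$. A bitopological space is a triple $\langle X,\tau^0,\tau^1\rangle$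 with $X\ne\varnothing$ and $\tau^0,\tau^1$ topologies on $X$. For $Y,Z\subseteq X$ put $e_{\tau^0,\tau^1}(Y,Z)=\{x\in X:\forall U\in\tau^1\,[x\in d_{\tau^0}(Y\cap U)\Rightarrow x\in d_{\tau^0}(Z\cap U)]\}$. A valuation on $\langle X,\tau^0,\tau^1\rangle$ is a map $v$ from formulas to subsets of $X$ with $v(\bot)=\varnothing$, $v(\top)=X$, Boolean clauses for $\neg,\land,\lor,\to$ (complement, intersection, union, $\overline{v(\varphi)}\cup v(\psi)$), $v(\Box\varphi)=cd_{\tau^0}(v(\varphi))$, $v(\Diamond\varphi)=d_{\tau^0}(v(\varphi))$, $v(\varphi\rhd\psi)=e_{\tau^0,\tau^1}(v(\varphi),v(\psi))$. A formula is valid in the space if $v(\varphi)=X$ for every valuation $v$; $\mathrm{Log}(X,\tau^0,\tau^1)$ is the set of valid formulas. For a normal extension $L$ of $\mathbf{CL}$, an $L$-space is a bitopological space with $L\subseteq\mathrm{Log}(X,\tau^0,\tau^1)$. $\Gamma\models_L^T\varphi$ means: for every $L$-space, every valuation $v$ on it and every point $x$, if $x\in v(\psi)$ for all $\psi\in\Gamma$ then $x\in v(\varphi)$. *)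

(* Defs.v *)
From HB Require Import structures.
From mathcomp Require Import all_boot.
From mathcomp Require Import all_classical.
From mathcomp Require Import topology.

Set Implicit Arguments.
Unset Strict Implicit.
Unset Printing Implicit Defensive.

Local Open Scope classical_set_scope.

Inductive form : Type :=
| Var of nat
| Top
| Bot
| Neg of form
| And of form & form
| Or of form & form
| Imp of form & form
| Box of form
| Dia of form
| Rhd of form & form.

Fixpoint subst (s : nat -> form) (f : form) : form :=
  match f with
  | Var n => s n
  | Top => Top
  | Bot => Bot
  | Neg g => Neg (subst s g)
  | And g h => And (subst s g) (subst s h)
  | Or g h => Or (subst s g) (subst s h)
  | Imp g h => Imp (subst s g) (subst s h)
  | Box g => Box (subst s g)
  | Dia g => Dia (subst s g)
  | Rhd g h => Rhd (subst s g) (subst s h)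
  end.

(* Variables and formulas headed by a modal operator are the atoms. *)
Fixpoint bool_eval (a : form -> bool) (f : form) : bool :=
  match f with
  | Top => true
  | Bot => false
  | Neg g => ~~ bool_eval a g
  | And g h => bool_eval a g && bool_eval a h
  | Or g h => bool_eval a g || bool_eval a h
  | Imp g h => bool_eval a g ==> bool_eval a h
  | Var _ | Box _ | Dia _ | Rhd _ _ => a f
  end.

Definition tautology (f : form) : Prop := forall a, bool_eval a f.

Local Notation p := (Var 0) (only parsing).
Local Notation q := (Var 1) (only parsing).
Local Notation r := (Var 2) (only parsing).

(* Since Dia is a constructor, its being the dual of Box is stated by the
   axioms CL_dual1 and CL_dual2. *)
Inductive CL : set form :=
| CL_taut f : tautology f -> CL f
| CL_dual1 : CL (Imp (Dia p) (Neg (Box (Neg p))))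
| CL_dual2 : CL (Imp (Neg (Box (Neg p))) (Dia p))
| CL_K : CL (Imp (Box (Imp p q)) (Imp (Box p) (Box q)))
| CL_Loeb : CL (Imp (Box (Imp (Box p) p)) (Box p))
| CL_J1 : CL (Imp (Box (Imp p q)) (Rhd p q))
| CL_J2 : CL (Imp (And (Rhd p q) (Rhd q r)) (Rhd p r))
| CL_J3 : CL (Imp (And (Rhd p r) (Rhd q r)) (Rhd (Or p q) r))
| CL_J4 : CL (Imp (Rhd p q) (Imp (Dia p) (Dia q)))
| CL_mp f g : CL (Imp f g) -> CL f -> CL g
| CL_nec f : CL f -> CL (Box f)
| CL_subst s f : CL f -> CL (subst s f).

Record normal_extension (L : set form) : Prop := NormalExtension {
  ne_CL : CL `<=` L;
  ne_mp : forall f g, L (Imp f g) -> L f -> L g;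
  ne_nec : forall f, L f -> L (Box f);
  ne_subst : forall s f, L f -> L (subst s f) }.

Definition consistent (L : set form) : Prop := ~ L Bot.

(* [Topological X] is the type of topologies on X, so that one carrier can
   bear two of them. *)
Definition opens (X : Type) (tau : Topological X) : set (set X) :=
  @open (Topological.Pack tau).

(* [Topological X] also packs a choice structure on X; this excludes no
   topology, as every family of open sets on an arbitrary type is obtained. *)
Lemma opens_surj (X : Type) (T : set (set X)) :
  T setT -> setI_closed T ->
  (forall (I : Type) (F : I -> set X),
     (forall i, T (F i)) -> T (\bigcup_i F i)) ->
  exists tau : Topological X, opens tau = T.
Proof.
move=> TT TI TU.
pose b := isOpenTopological.Build {classic X} TT TI TU.
pose S : topologicalType := HB.pack {classic X} b.
by exists (Topological.class S).
Qed.

Definition derived (X : Type) (tau : Topological X) (Y : set X) : set X :=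
  [set x | forall U, opens tau U -> U x -> exists y, [/\ y <> x, U y & Y y]].

Lemma derivedE (X : Type) (tau : Topological X) (Y : set X) :
  derived tau Y = @limit_point (Topological.Pack tau) Y.
Proof.
apply/seteqP; split => x /= dx U.
- rewrite nbhsE => -[V [oV Vx] VU].
  have [y [yx Vy Yy]] := dx V oV Vx.
  by exists y; split => //; [exact/eqP | exact: VU].
- move=> oU Ux.
  have [|y [/eqP yx Yy Uy]] := dx U; last by exists y.
  exact: (@open_nbhs_nbhs (Topological.Pack tau)).
Qed.

Definition coderived (X : Type) (tau : Topological X) (Y : set X) : set X :=
  ~` derived tau (~` Y).

Definition rhd_op (X : Type) (tau0 tau1 : Topological X) (Y Z : set X) :
    set X :=
  [set x | forall U, opens tau1 U ->
             derived tau0 (Y `&` U) x -> derived tau0 (Z `&` U) x].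

Record bispace : Type := Bispace {
  carrier :> Type;
  top0 : Topological carrier;
  top1 : Topological carrier;
  carrier_nonempty : [set: carrier] !=set0 }.

Record is_valuation (B : bispace) (v : form -> set B) : Prop := IsValuation {
  val_Top : v Top = setT;
  val_Bot : v Bot = set0;
  val_Neg : forall f, v (Neg f) = ~` v f;
  val_And : forall f g, v (And f g) = v f `&` v g;
  val_Or : forall f g, v (Or f g) = v f `|` v g;
  val_Imp : forall f g, v (Imp f g) = ~` v f `|` v g;
  val_Box : forall f, v (Box f) = coderived (top0 B) (v f);
  val_Dia : forall f, v (Dia f) = derived (top0 B) (v f);
  val_Rhd : forall f g, v (Rhd f g) = rhd_op (top0 B) (top1 B) (v f) (v g) }.

Definition Log (B : bispace) : set form :=
  [set f | forall v : form -> set B, is_valuation v -> v f = setT].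

Definition L_space (L : set form) (B : bispace) : Prop := L `<=` Log B.

Definition top_consequence (L Gamma : set form) (phi : form) : Prop :=
  forall B : bispace, L_space L B ->
  forall v : form -> set B, is_valuation v ->
  forall x : B, (forall psi, Gamma psi -> v psi x) -> v phi x.

(* Main.v *)
(* Compactness follows from closure of L-spaces under ultrabouquets.  Given
   spaces X_i with points x_i and an ultrafilter F on the indices, adjoin to the
   disjoint sum of the X_i a new point whose tau^0-neighbourhoods contain, for
   F-many i, a punctured neighbourhood of x_i.  Loeb's axiom makes tau^0
   scattered, so x_i has an open neighbourhood that remains open when x_i is
   removed.  Hence truth at the new point is truth at F-many x_i, both for the
   formulas of L and for a family of models of the finite subsets of Gamma. *)
Require Import Defs.
From mathcomp Require Import all_boot.
From mathcomp Require Import all_classical.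
From mathcomp Require Import topology.

Set Implicit Arguments.
Unset Strict Implicit.

Local Open Scope classical_set_scope.

(** * Dependent pairs and ultrafilters *)

Lemma existT_inj (I : Type) (B : I -> Type) (i : I) (u w : B i) :
  existT B i u = existT B i w -> u = w.
Proof.
move=> e; have := projT2_eq e.
by rewrite (Prop_irrelevance (projT1_eq e) erefl).
Qed.

Lemma ultra_setC (I : Type) (F : set_system I) (A : set I) :
  UltraFilter F -> F (~` A) <-> ~ F A.
Proof.
move=> FU; split=> [FCA FA|nFA].
  by have [i []] := filter_ex (filterI FA FCA).
by have [] := in_ultra_setVsetC A FU.
Qed.

Lemma ultra_setI (I : Type) (F : set_system I) (A A' : set I) :
  UltraFilter F -> F (A `&` A') <-> F A /\ F A'.
Proof.
move=> FU; split=> [FI|[]]; last exact: filterI.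
by split; apply: filterS FI => i [].
Qed.

Lemma ultra_setU (I : Type) (F : set_system I) (A A' : set I) :
  UltraFilter F -> F (A `|` A') <-> F A \/ F A'.
Proof.
move=> FU; split=> [FUn|[] FA]; last 2 first.
- by apply: filterS FA => i; left.
- by apply: filterS FA => i; right.
apply: contrapT => /not_orP[/(ultra_setC _ FU) nA /(ultra_setC _ FU) nA'].
by have [i [[?|?] []]] := filter_ex (filterI FUn (filterI nA nA')).
Qed.

Lemma filter_iff (I : Type) (F : set_system I) (A A' : set I) :
  Filter F -> (forall i, A i <-> A' i) -> F A <-> F A'.
Proof. by move=> FF AA'; split; apply: filterS => i /AA'. Qed.

(** * Derived sets and germs at a point *)

Section Topologies.
Context {X : Type}.
Implicit Types (tau : Topological X) (Y Z : set X).

Lemma opensT tau : opens tau setT.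
Proof. exact: (@openT (Topological.Pack tau)). Qed.

Lemma opens_set0 tau : opens tau set0.
Proof. exact: (@open0 (Topological.Pack tau)). Qed.

Lemma opensI tau Y Z : opens tau Y -> opens tau Z -> opens tau (Y `&` Z).
Proof. exact: (@openI (Topological.Pack tau)). Qed.

Lemma opens_bigcup tau (I : Type) (D : set I) (f : I -> set X) :
  (forall i, D i -> opens tau (f i)) -> opens tau (\bigcup_(i in D) f i).
Proof. exact: (@bigcup_open (Topological.Pack tau)). Qed.

Definition inner tau Y : set X :=
  \bigcup_(U in [set U | opens tau U /\ U `<=` Y]) U.

Lemma opens_inner tau Y : opens tau (inner tau Y).
Proof. by apply: opens_bigcup => U []. Qed.

Lemma inner_sub tau Y : inner tau Y `<=` Y.
Proof. by move=> y [U [_ UY] /UY]. Qed.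

Lemma sub_inner tau U Y : opens tau U -> U `<=` Y -> U `<=` inner tau Y.
Proof. by move=> oU UY y Uy; exists U. Qed.

(** [Y] need not contain [x]: whether [x] lies in a derived set does not depend on [x] itself. *)
Definition punctured_nbhs tau (x : X) Y : Prop :=
  exists O, [/\ opens tau O, O x & forall y, O y -> y <> x -> Y y].

Lemma punctured_nbhs_open tau x U Y :
  opens tau U -> U x -> U `<=` Y -> punctured_nbhs tau x Y.
Proof. by move=> oU Ux UY; exists U; split => // y /UY. Qed.

Lemma derivedN tau x Y : ~ derived tau Y x <-> punctured_nbhs tau x (~` Y).
Proof.
split=> [/existsNP[O /not_implyP[oO /not_implyP[Ox nO]]]|[O [oO Ox OY]]].
  by exists O; split => // y Oy yx Yy; apply: nO; exists y.
by move=> /(_ O oO Ox)[y [yx Oy Yy]]; exact: (OY y).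
Qed.

Lemma derived_mono tau x Y Z :
  punctured_nbhs tau x [set y | Y y -> Z y] -> derived tau Y x -> derived tau Z x.
Proof.
move=> [O [oO Ox OYZ]] dY U oU Ux.
have [y [yx [Oy Uy] Yy]] := dY _ (opensI oO oU) (conj Ox Ux).
by exists y; split => //; exact: OYZ.
Qed.

Lemma derived_germ tau x Y Z :
  punctured_nbhs tau x [set y | Y y <-> Z y] -> derived tau Y x <-> derived tau Z x.
Proof.
move=> [O [oO Ox OYZ]]; split; apply: derived_mono; exists O; split => // y Oy yx.
- exact: (OYZ y Oy yx).1.
- exact: (OYZ y Oy yx).2.
Qed.

Lemma coderived_germ tau x Y Z :
  punctured_nbhs tau x [set y | Y y <-> Z y] ->
  coderived tau Y x <-> coderived tau Z x.
Proof.
move=> [O [oO Ox OYZ]]; rewrite /coderived /setC /=.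
suff: derived tau (~` Y) x <-> derived tau (~` Z) x by tauto.
apply: derived_germ; exists O; split => // y Oy yx /=.
by have := OYZ y Oy yx; rewrite /setC /=; tauto.
Qed.

(** The same [U] is tested on both sides, and each test concerns a derived set at [x], so a
    [tau]-neighbourhood suffices whatever [tau1] is. *)
Lemma rhd_op_germ tau tau1 x Y Y' Z Z' :
  punctured_nbhs tau x [set y | (Y y <-> Y' y) /\ (Z y <-> Z' y)] ->
  rhd_op tau tau1 Y Z x <-> rhd_op tau tau1 Y' Z' x.
Proof.
move=> [O [oO Ox OYZ]].
have dY U : derived tau (Y `&` U) x <-> derived tau (Y' `&` U) x.
  apply: derived_germ; exists O; split => // y Oy yx.
  by have [YY' _] := OYZ y Oy yx; rewrite /setI /=; tauto.
have dZ U : derived tau (Z `&` U) x <-> derived tau (Z' `&` U) x.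
  apply: derived_germ; exists O; split => // y Oy yx.
  by have [_ ZZ'] := OYZ y Oy yx; rewrite /setI /=; tauto.
by split=> e U oU /dY/(e U oU)/dZ.
Qed.

(** Equivalently, {x} is locally closed: the T_D separation property at [x]. *)
Definition detachable tau (x : X) : Prop :=
  exists U, [/\ opens tau U, U x & opens tau (U `\ x)].

Lemma scattered_detachable tau :
  (forall A, A `<=` derived tau A -> A = set0) -> forall x, detachable tau x.
Proof.
move=> scat x.
(* [A] is the closure of {x}. Scatteredness gives it an isolated point [a]; every neighbourhood of
   [a] contains [x], so [a] is [x]. *)
pose A := [set y | forall U, opens tau U -> U y -> U x].
have Ax : A x by move=> U.
have /existsNP[a /not_implyP[Aa /derivedN[U [oU Ua UA]]]] : ~ A `<=` derived tau A.
  by move=> /scat A0; rewrite A0 in Ax.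
have Ux := Aa U oU Ua.
have ax : x = a by apply: contrapT => xa; exact: (UA x Ux xa).
rewrite -ax in UA; exists U; split => //.
(* Points of [U] other than [x] lie outside that closure, hence have a neighbourhood missing [x]. *)
suff -> : U `\ x = inner tau (U `\ x) by exact: opens_inner.
apply/seteqP; split; last exact: inner_sub.
move=> y [Uy yx].
have /existsNP[V /not_implyP[oV /not_implyP[Vy nVx]]] := UA y Uy yx.
exists (U `&` V); last by [].
split; first exact: opensI.
by move=> z [Uz Vz]; split => // zx; apply: nVx; rewrite -zx.
Qed.

End Topologies.

(** * Evaluation of formulas and locality of truth *)

Fixpoint eval (B : bispace) (a : nat -> set B) (f : form) : set B :=
  match f with
  | Var n => a n
  | Top => setT
  | Bot => set0
  | Neg g => ~` eval a g
  | And g h => eval a g `&` eval a h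
  | Or g h => eval a g `|` eval a h
  | Imp g h => ~` eval a g `|` eval a h
  | Box g => coderived (top0 B) (eval a g)
  | Dia g => derived (top0 B) (eval a g)
  | Rhd g h => rhd_op (top0 B) (top1 B) (eval a g) (eval a h)
  end.

Lemma eval_valuation (B : bispace) (a : nat -> set B) : is_valuation (eval a).
Proof. by []. Qed.

Lemma valuation_eval (B : bispace) (v : form -> set B) :
  is_valuation v -> v = eval (fun n => v (Var n)).
Proof.
move=> [vT vB vN vA vO vI vX vD vR]; apply/funext.
elim=> [n|||f IH|f IHf g IHg|f IHf g IHg|f IHf g IHg|f IH|f IH|f IHf g IHg] //=.
- by rewrite vN IH.
- by rewrite vA IHf IHg.
- by rewrite vO IHf IHg.
- by rewrite vI IHf IHg.
- by rewrite vX IH.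
- by rewrite vD IH.
- by rewrite vR IHf IHg.
Qed.

(** [W] is a neighbourhood of each of its points, and every modal operator at a point depends only
    on the germs of its arguments there. *)
Lemma eval_local (B : bispace) (W : set B) (a b : nat -> set B) :
  opens (top0 B) W -> (forall n y, W y -> a n y <-> b n y) ->
  forall f y, W y -> eval a f y <-> eval b f y.
Proof.
move=> oW ab.
elim=> [n|||f IH|f IHf g IHg|f IHf g IHg|f IHf g IHg|f IH|f IH|f IHf g IHg] y Wy //=.
- exact: ab.
- by have := IH y Wy; rewrite /setC /=; tauto.
- by have := IHf y Wy; have := IHg y Wy; rewrite /setI /=; tauto.
- by have := IHf y Wy; have := IHg y Wy; rewrite /setU /=; tauto.
- by have := IHf y Wy; have := IHg y Wy; rewrite /setU /setC /=; tauto.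
- by apply: coderived_germ; apply: (punctured_nbhs_open (U := W)).
- by apply: derived_germ; apply: (punctured_nbhs_open (U := W)).
- apply: rhd_op_germ; apply: (punctured_nbhs_open (U := W)) => // z Wz.
  by split; [exact: IHf | exact: IHg].
Qed.

Lemma L_space_scattered (L : set form) (B : bispace) :
  normal_extension L -> L_space L B ->
  forall A : set B, A `<=` derived (top0 B) A -> A = set0.
Proof.
move=> hL hB A Ad.
(* With p false exactly on [A], Box p holds off the derived set of [A]. As [A] lies in that set, Box
   p -> p holds everywhere, so Loeb's axiom makes Box p hold everywhere. *)
have := hB _ (ne_CL hL CL_Loeb) _ (eval_valuation (fun=> ~` A)).
rewrite /= /coderived !setCK => loeb.
have dA0 : derived (top0 B) A = set0.
  apply/seteqP; split => // x dAx.
  have : [set: B] x by [].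
  rewrite -loeb => -[|//]; apply/derivedN.
  exists setT; split; [exact: opensT | by [] | move=> y _ _].
  by apply; have [Ay|] := EM (A y); [left; exact: Ad | right].
by apply/seteqP; split => // x /Ad; rewrite dA0.
Qed.

(** * The ultrabouquet of pointed spaces *)

Section Bouquet.
Context {I : Type} {F : set_system I} {FU : UltraFilter F}.
Context {B : I -> bispace} {x : forall i, B i}.

(** [None] is the new point, the root; [Some] carries the disjoint sum. *)
Definition sum_point (i : I) (y : B i) : option {i & B i} := Some (existT _ i y).
Arguments sum_point : clear implicits.

(** A neighbourhood of the root may omit the copies of the [x i]: the root imitates the [x i], and
    derived sets at [x i] ignore [x i]. *)
Definition bouquet_open0 (U : set (option {i & B i})) : Prop :=
  (forall i, opens (top0 (B i)) (sum_point i @^-1` U)) /\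
  (U None -> F [set i | punctured_nbhs (top0 (B i)) (x i) (sum_point i @^-1` U)]).

(* The new point is tau^1-isolated; only traces on punctured
   tau^0-neighbourhoods matter for the semantics of Rhd. *)
Definition bouquet_open1 (U : set (option {i & B i})) : Prop :=
  forall i, opens (top1 (B i)) (sum_point i @^-1` U).

Lemma bouquet_top0 : exists tau, opens tau = bouquet_open0.
Proof.
apply: opens_surj.
- split=> [i|_]; first exact: opensT.
  by apply: filterE => i; exists setT; split => //; exact: opensT.
- move=> U V [oU FUn] [oV FVn]; split=> [i|[/FUn FUN /FVn FVN]].
    exact: opensI (oU i) (oV i).
  apply: filterS (filterI FUN FVN) => i [[O [oO Ox OU]] [O' [oO' Ox' OV]]].
  exists (O `&` O'); split => //; first exact: opensI.
  by move=> y [Oy O'y] yx; split; [exact: OU | exact: OV].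
- move=> J U oU; split=> [i|[j _ Uj]].
    by apply: opens_bigcup => j _; exact: (oU j).1.
  apply: filterS ((oU j).2 Uj) => i [O [oO Ox OU]].
  by exists O; split => // y Oy yx; exists j => //; exact: OU.
Qed.

Lemma bouquet_top1 : exists tau, opens tau = bouquet_open1.
Proof.
apply: opens_surj.
- by move=> i; exact: opensT.
- by move=> U V oU oV i; exact: opensI (oU i) (oV i).
- by move=> J U oU i; apply: opens_bigcup => j _; exact: oU.
Qed.

Definition sum_image (i : I) (U : set (B i)) : set (option {i & B i}) :=
  [set z | exists2 u, U u & z = sum_point i u].

Lemma sum_imageK i (U : set (B i)) : sum_point i @^-1` sum_image U = U.
Proof.
apply/seteqP; split => y; last by exists y.
by move=> [u Uu /Some_inj e]; rewrite (existT_inj e).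
Qed.

Lemma sum_image_neq i j (U : set (B i)) :
  i <> j -> sum_point j @^-1` sum_image U = set0.
Proof.
by move=> ij; apply/seteqP; split => // y [u _ /Some_inj /projT1_eq /= /esym].
Qed.

Lemma sum_image_open0 i (U : set (B i)) :
  opens (top0 (B i)) U -> bouquet_open0 (sum_image U).
Proof.
move=> oU; split=> [j|[//]]; case: (pselect (i = j)) => [<-|ij].
  by rewrite sum_imageK.
by rewrite sum_image_neq //; exact: opens_set0.
Qed.

Lemma sum_image_open1 i (U : set (B i)) :
  opens (top1 (B i)) U -> bouquet_open1 (sum_image U).
Proof.
move=> oU j; case: (pselect (i = j)) => [<-|ij].
  by rewrite sum_imageK.
by rewrite sum_image_neq //; exact: opens_set0.
Qed.

Context (tau0 tau1 : Topological (option {i & B i})).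
Hypothesis tau0E : opens tau0 = bouquet_open0.
Hypothesis tau1E : opens tau1 = bouquet_open1.
Hypothesis x_detachable : forall i, detachable (top0 (B i)) (x i).

(** Each summand is an open subspace: its open sets stay open under [sum_image], and traces of open
    sets are open. *)
Lemma derived_sum i Y :
  sum_point i @^-1` derived tau0 Y = derived (top0 (B i)) (sum_point i @^-1` Y).
Proof.
apply/seteqP; split => y dY U oU Uy.
  have [||z [zy [u Uu zu] Yz]] := dY (sum_image U).
  - by rewrite tau0E; exact: sum_image_open0.
  - by exists y.
  by subst z; exists u; split => // uy; apply: zy; rewrite uy.
rewrite tau0E in oU; have [u [uy Uu Yu]] := dY _ (oU.1 i) Uy.
by exists (sum_point i u); split => // /Some_inj e; apply: uy; exact: existT_inj e.
Qed.

Lemma coderived_sum i Y :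
  sum_point i @^-1` coderived tau0 Y = coderived (top0 (B i)) (sum_point i @^-1` Y).
Proof. by rewrite /coderived -preimage_setC derived_sum. Qed.

Lemma rhd_op_sum i Y Z :
  sum_point i @^-1` rhd_op tau0 tau1 Y Z =
  rhd_op (top0 (B i)) (top1 (B i)) (sum_point i @^-1` Y) (sum_point i @^-1` Z).
Proof.
have dI A U y : derived tau0 (A `&` U) (sum_point i y) =
    derived (top0 (B i)) (sum_point i @^-1` A `&` sum_point i @^-1` U) y.
  by rewrite -preimage_setI -derived_sum.
apply/seteqP; split => y e U oU.
  have := e (sum_image U); rewrite !dI sum_imageK; apply.
  by rewrite tau1E; exact: sum_image_open1.
by rewrite !dI; apply: e; rewrite tau1E in oU.
Qed.

(** A neighbourhood of the root missing [Y] amounts to punctured neighbourhoods of F-many [x i]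
    missing the traces of [Y]. As [F] is an ultrafilter, the negated statements can be compared. *)
Lemma derived_root Y :
  derived tau0 Y None <->
  F [set i | derived (top0 (B i)) (sum_point i @^-1` Y) (x i)].
Proof.
suff H : ~ derived tau0 Y None <->
    F (~` [set i | derived (top0 (B i)) (sum_point i @^-1` Y) (x i)]).
  rewrite ultra_setC in H.
  by split=> D; apply: contrapT => /H.
rewrite derivedN; split=> [[U [oU UN UY]]|FY].
  rewrite tau0E in oU; apply: filterS (oU.2 UN) => i [O [oO Ox OU]].
  by apply/derivedN; exists O; split => // y Oy yx; exact: UY (OU y Oy yx) _.
pose V i := inner (top0 (B i)) (~` (sum_point i @^-1` Y)).
exists [set z | if z is Some s then V (projT1 s) (projT2 s) else True].
split => //; last by case=> // -[i y] Vy _; exact: (inner_sub Vy).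
rewrite tau0E; split=> [i|_]; first exact: (opens_inner _ (~` (sum_point i @^-1` Y))).
apply: filterS FY => i nd; have [O [oO Ox OY]] := (derivedN _ _ _).1 nd.
have [T [oT Tx oTx]] := x_detachable i.
exists (O `&` T); split => //; first exact: opensI.
(* [O] itself may fail to lie in [V i], as [x i] may be in the trace of [Y]; detaching [x i] leaves
   an open set that avoids it. *)
move=> y [Oy Ty] yx; apply: (sub_inner (U := O `&` (T `\ x i))) => //.
  exact: opensI.
by move=> z [Oz [_ zx]]; exact: OY.
Qed.

Lemma coderived_root Y :
  coderived tau0 Y None <->
  F [set i | coderived (top0 (B i)) (sum_point i @^-1` Y) (x i)].
Proof.
rewrite [X in _ <-> F X](_ : _ =
  ~` [set i | derived (top0 (B i)) (sum_point i @^-1` (~` Y)) (x i)]) //.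
by rewrite ultra_setC -derived_root.
Qed.

(** If the condition fails at F-many [x i], the [top1]-open sets refuting it glue to one [tau1]-open
    set refuting it at the root. Conversely, traces of [tau1]-open sets are open and [derived_root]
    applies. *)
Lemma rhd_op_root Y Z :
  rhd_op tau0 tau1 Y Z None <->
  F [set i | rhd_op (top0 (B i)) (top1 (B i))
                    (sum_point i @^-1` Y) (sum_point i @^-1` Z) (x i)].
Proof.
split=> [e|Fe U]; last first.
  rewrite tau1E => oU /derived_root FY; apply/derived_root.
  by apply: filterS (filterI Fe FY) => i [ei]; exact: ei (oU i).
apply: contrapT => /(ultra_setC _ FU) Fne.
pose bad i (U : set (B i)) :=
  derived (top0 (B i)) (sum_point i @^-1` Y `&` U) (x i) /\
  ~ derived (top0 (B i)) (sum_point i @^-1` Z `&` U) (x i).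
(* A refuting set where one exists, the empty set as default. *)
have /(_ _)/cid pick i : exists U, opens (top1 (B i)) U /\
    ((exists2 U', opens (top1 (B i)) U' & bad i U') -> bad i U).
  case: (pselect (exists2 U', opens (top1 (B i)) U' & bad i U')) => [[U oU bU]|nU].
    by exists U.
  by exists set0; split => //; exact: opens_set0.
pose U i := projT1 (pick i).
have FU' : F [set i | bad i (U i)].
  apply: filterS Fne => i /existsNP[V /not_implyP[oV /not_implyP[dY dZ]]].
  by apply: (projT2 (pick i)).2; exists V.
pose W := [set z : option {i & B i} |
  if z is Some s then U (projT1 s) (projT2 s) else True].
have oW : opens tau1 W by rewrite tau1E => i; exact: (projT2 (pick i)).1.
have /derived_root FZ : derived tau0 (Z `&` W) None.
  by apply: e => //; apply/derived_root; apply: filterS FU' => i [].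
by have [i [[_]]] := filter_ex (filterI FU' FZ).
Qed.

Definition bouquet : bispace :=
  @Bispace (option {i & B i}) tau0 tau1 (ex_intro _ None Logic.I).

Lemma eval_sum (a : nat -> set bouquet) i f :
  sum_point i @^-1` eval a f = eval (fun n => sum_point i @^-1` a n) f.
Proof.
elim: f => [n|||f IH|f IHf g IHg|f IHf g IHg|f IHf g IHg|f IH|f IH|f IHf g IHg] //=.
- by rewrite -IH.
- by rewrite -IHf -IHg.
- by rewrite -IHf -IHg.
- by rewrite -IHf -IHg.
- by rewrite coderived_sum IH.
- by rewrite derived_sum IH.
- by rewrite rhd_op_sum IHf IHg.
Qed.

(* The valuation at the summand's own copy of [x i] is irrelevant to the root,
   so [b] may differ from [a] there. *)
Lemma eval_root (a : nat -> set bouquet) (b : forall i, nat -> set (B i)) :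
  (forall i n y, y <> x i -> b i n y <-> a n (sum_point i y)) ->
  (forall n, a n None <-> F [set i | b i n (x i)]) ->
  forall f, eval a f None <-> F [set i | eval (b i) f (x i)].
Proof.
move=> ab aN.
(* Off [x i] the two assignments agree on the open set [T] minus [x i], so locality of truth gives
   agreement there for all formulas. *)
have germ i f : punctured_nbhs (top0 (B i)) (x i)
    [set y | eval a f (sum_point i y) <-> eval (b i) f y].
  have [T [oT Tx oTx]] := x_detachable i; exists T; split => // y Ty yx /=.
  rewrite -[eval a f _]/((sum_point i @^-1` eval a f) y) eval_sum.
  by apply: (eval_local oTx) => // n z [_ zx]; rewrite ab.
elim=> [n|||f IH|f IHf g IHg|f IHf g IHg|f IHf g IHg|f IH|f IH|f IHf g IHg] /=.
- exact: aN.
- by split=> // _; exact: filterT.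
- by split=> // F0; exact: (filter_not_empty F).
- by rewrite -[X in F X]/(~` _) ultra_setC -IH.
- by rewrite -[X in F X]/(_ `&` _) ultra_setI -IHf -IHg.
- by rewrite -[X in F X]/(_ `|` _) ultra_setU -IHf -IHg.
- by rewrite -[X in F X]/(~` _ `|` _) ultra_setU ultra_setC -IHf -IHg.
- by rewrite coderived_root; apply: filter_iff => i; exact: coderived_germ (germ i f).
- by rewrite derived_root; apply: filter_iff => i; exact: derived_germ (germ i f).
- rewrite rhd_op_root; apply: filter_iff => i; apply: rhd_op_germ.
  have [O [oO Ox Of]] := germ i f; have [O' [oO' Ox' Og]] := germ i g.
  exists (O `&` O'); split => //; first exact: opensI.
  by move=> y [Oy O'y] yx; split; [exact: Of | exact: Og].
Qed.

Lemma L_space_bouquet (L : set form) :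
  (forall i, L_space L (B i)) -> L_space L bouquet.
Proof.
move=> hB f Lf v /valuation_eval ->; set a := fun n => v (Var n).
apply/seteqP; split => // -[[i y] _|_].
  suff : (sum_point i @^-1` eval a f) y by [].
  by rewrite eval_sum (hB i f Lf _ (eval_valuation _)).
(* Every [x i] receives the atoms of the root, so the index set of each atom is everything or empty.
   Formulas of [L] hold at all [x i], hence at the root. *)
pose b i n : set (B i) :=
  [set y | (y <> x i /\ a n (sum_point i y)) \/ (y = x i /\ a n None)].
apply/(@eval_root a b).
- by move=> i n y yx; rewrite /b /=; tauto.
- move=> n; split=> [aN|/filter_ex[i []] []//].
  by apply: filterE => i; right.
- by apply: filterE => i /=; rewrite (hB i f Lf _ (eval_valuation _)).
Qed.

End Bouquet.

(** * Compactness from a bouquet of countermodels *)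

Record pointed_model : Type := PointedModel {
  space : bispace;
  atoms : nat -> set space;
  point : space }.

Unset Implicit Arguments.

Theorem theorem4p13 (L : set form) (hL : normal_extension L)
    (hcons : consistent L) (Gamma : set form) (phi : form) :
  top_consequence L Gamma phi ->
  exists Gamma0 : set form,
    [/\ finite_set Gamma0, Gamma0 `<=` Gamma & top_consequence L Gamma0 phi].
Proof.
move=> cons; apply: contrapT => nfin.
pose fin (S : set form) := finite_set S /\ S `<=` Gamma.
pose counter (S : set form) (m : pointed_model) :=
  [/\ L_space L (space m), ~ eval (@atoms m) phi (point m) &
      forall psi, S psi -> eval (@atoms m) psi (point m)].
have counterP S : fin S -> exists m, counter S m.
  move=> [finS SG]; apply: contrapT => nm; apply: nfin; exists S; split => //.
  move=> X LX v vv x xS; apply: contrapT => nphi; apply: nm.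
  exists (PointedModel (fun n => v (Var n)) x).
  by split => //=; rewrite -(valuation_eval vv).
(* [m0] serves the indices that are not finite subsets of [Gamma], so that every space of the family
   is an L-space. *)
have [m0 [Lm0 _ _]] : exists m, counter set0 m by apply: counterP; split.
have /choice[m mP] S : exists m, L_space L (space m) /\ (fin S -> counter S m).
  case: (pselect (fin S)) => [finS|nfinS]; last by exists m0.
  by have [m mP] := counterP S finS; exists m; split => //; case: mP.
(* The filter generated by the cones above finite subsets of [Gamma]. *)
pose G : set_system (set form) :=
  [set A | exists2 S0, fin S0 & forall S, fin S -> S0 `<=` S -> A S].
have GP : ProperFilter G.
  split; first by move=> [S fS /(_ S fS)]; exact.
  split.
  - by exists set0 => //; split.
  - move=> A A' [S [fS SG] SA] [S' [fS' SG'] SA'].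
    exists (S `|` S'); first by split; [rewrite finite_setU | rewrite subUset].
    by move=> S'' fS''; rewrite subUset => -[? ?]; split; [exact: SA | exact: SA'].
  - by move=> A A' AA' [S fS SA]; exists S => // S' fS' /(SA _ fS')/AA'.
have [F [FU GF]] := ultraFilterLemma GP.
pose B S := space (m S); pose x S : B S := point (m S).
have LB S : L_space L (B S) := (mP S).1.
have det S : detachable (top0 (B S)) (x S).
  exact: scattered_detachable (L_space_scattered hL (LB S)) _.
have [tau0 tau0E] := bouquet_top0 (F := F) (x := x).
have [tau1 tau1E] := bouquet_top1 (B := B).
(* An atom holds at the root when it holds at the base points of F-many models. *)
pose a n : set (bouquet tau0 tau1) := [set z |
  if z is Some s then @atoms (m (projT1 s)) n (projT2 s)
  else F [set S | @atoms (m S) n (x S)]].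
have root f : eval a f None <-> F [set S | eval (@atoms (m S)) f (x S)].
  exact: (eval_root tau0E tau1E det (a := a) (b := fun S => @atoms (m S))).
have /root Fphi : eval a phi None.
  apply: (cons _ _ _ (eval_valuation a)).
    exact: (L_space_bouquet tau0E tau1E det LB).
  (* The cone above {psi} is in [F], and the models indexed by it satisfy [psi]. *)
  move=> psi Gpsi; apply/root; apply: GF; exists [set psi].
    by split; [exact: finite_set1 | move=> _ ->].
  by move=> S fS; rewrite sub1set inE => Spsi; have [_ _] := (mP S).2 fS; apply.
(* [F] contains the set of finite subsets of [Gamma], at which [phi] fails by the choice of [m],
   against [Fphi]. *)
have Gfin : F fin by apply: GF; exists set0 => //; split.
have [S [/(mP S).2 []]] := filter_ex (filterI Gfin Fphi).
by [].
Qed.
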